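(* In the social learning model with Gaussian signals of variance $\sigma^2>0$, conditioned on $\theta=+1$, $$\lim_{t\to\infty}\frac{\ell_t}{(2\sqrt{2}/\sigma)\sqrt{\log t}}=1$$ with probability $1$.
   Context: Social learning model. A state $\theta\in\{-1,+1\}$ is drawn with $\mathbb{P}(\theta=+1)=\mathbb{P}(\theta=-1)=1/2$. Agents $t=1,2,\dots$ receive private signals $s_t\in\mathbb{R}$ that are i.i.d. conditionally on $\theta$, with CDF $F_+$ if $\theta=+1$ and $F_-$ if $\theta=-1$; $F_+$ and $F_-$ are mutually absolutely continuous. Let $L_t=\log\frac{\mathbb{P}(\theta=+1\mid s_t)}{\mathbb{P}(\theta=-1\mid s_t)}$ be the private log-likelihood ratio, and let $G_+$, $G_-$ denote the CDFs of $L_t$ conditional on $\theta=+1$, $\theta=-1$ respectively. Signals are assumed unbounded: for every $M\in\mathbb{R}$, $\mathbb{P}(L_t>M)>0$ and $\mathbb{P}(L_t<-M)>0$. Agent $t$ observes $a_1,\dots,a_{t-1}$ and her own signal and chooses $a_t\in\{-1,+1\}$ (utility $1$ if $a_t=\theta$, else $0$). The public belief is $\mu_t=\mathbb{P}(\theta=+1\mid a_1,\dots,a_{t-1})$ and $\ell_t=\log\frac{\mu_t}{1-\mu_t}$ (so $\ell_1=0$). In equilibrium $a_t=+1$ iff $\ell_t+L_t>0$, and otherwise $a_t=-1$. Consequently $\ell_{t+1}=\ell_t+D_+(\ell_t)$ if $a_t=+1$ and $\ell_{t+1}=\ell_t+D_-(\ell_t)$ if $a_t=-1$, where $D_+(x)=\log\frac{1-G_+(-x)}{1-G_-(-x)}$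 and $D_-(x)=\log\frac{G_+(-x)}{G_-(-x)}$. We write $\mathbb{P}_+(\cdot)=\mathbb{P}(\cdot\mid\theta=+1)$ and $\mathbb{E}_+$ for the corresponding expectation. Gaussian signals: $F_+$ is the normal distribution with mean $+1$ and variance $\sigma^2$, and $F_-$ is the normal distribution with mean $-1$ and variance $\sigma^2$. *)

(* Defs.v *)
From Stdlib Require Import Reals Lra.
Open Scope R_scope.

(** Standard normal density. The standard normal CDF [Phi] is passed to the
    theorem as a binder characterised by [Phi' = gauss_density] and
    [Phi(x) -> 0] as [x -> -oo] (this determines Phi uniquely). *)
Definition gauss_density (x : R) : R := exp (- (x * x) / 2) / sqrt (2 * PI).

Definition is_std_normal_cdf (Phi : R -> R) : Prop :=
  (forall x, derivable_pt_lim Phi x (gauss_density x)) /\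
  (forall eps, 0 < eps -> exists M, forall x, x < M -> Rabs (Phi x) < eps).

Definition F_plus (sigma : R) (Phi : R -> R) (s : R) : R := Phi ((s - 1) / sigma).
Definition F_minus (sigma : R) (Phi : R -> R) (s : R) : R := Phi ((s + 1) / sigma).

(** Densities and the private log-likelihood ratio L(s) (prior 1/2, so the
    posterior log-odds equals the log likelihood ratio). *)
Definition dens_plus (sigma s : R) : R :=
  exp (- ((s - 1) * (s - 1)) / (2 * (sigma * sigma))) / (sigma * sqrt (2 * PI)).
Definition dens_minus (sigma s : R) : R :=
  exp (- ((s + 1) * (s + 1)) / (2 * (sigma * sigma))) / (sigma * sqrt (2 * PI)).
Definition llr (sigma s : R) : R := ln (dens_plus sigma s / dens_minus sigma s).

Lemma llr_eq (sigma s : R) : 0 < sigma -> llr sigma s = 2 * s / (sigma * sigma).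
Proof.
  intros Hs. unfold llr, dens_plus, dens_minus.
  assert (Hc : 0 < sigma * sqrt (2 * PI)).
  { apply Rmult_lt_0_compat; [lra|]. apply sqrt_lt_R0. pose proof PI_RGT_0; lra. }
  set (c := sigma * sqrt (2 * PI)) in *.
  set (a := - ((s - 1) * (s - 1)) / (2 * (sigma * sigma))).
  set (b := - ((s + 1) * (s + 1)) / (2 * (sigma * sigma))).
  replace (exp a / c / (exp b / c)) with (exp (a + - b)).
  2:{ rewrite exp_plus, exp_Ropp. pose proof (exp_pos b).
      field. split; lra. }
  rewrite ln_exp. unfold a, b. field. lra.
Qed.

(** CDFs of L under theta = +1 / -1.  Since L(s) = 2 s / sigma^2 is strictly
    increasing (lemma [llr_eq]), {L <= x} = {s <= sigma^2 x / 2}. *)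
Definition G_plus (sigma : R) (Phi : R -> R) (x : R) : R :=
  F_plus sigma Phi (sigma * sigma * x / 2).
Definition G_minus (sigma : R) (Phi : R -> R) (x : R) : R :=
  F_minus sigma Phi (sigma * sigma * x / 2).

Lemma llr_le_iff (sigma s x : R) : 0 < sigma ->
  (llr sigma s <= x <-> s <= sigma * sigma * x / 2).
Proof.
  intros Hs. rewrite llr_eq by exact Hs.
  assert (H2 : 0 < sigma * sigma) by nra.
  split; intro H.
  - apply Rmult_le_reg_r with (r := 2 / (sigma * sigma)).
    + apply Rdiv_lt_0_compat; lra.
    + replace (sigma * sigma * x / 2 * (2 / (sigma * sigma))) with x by (field; lra).
      replace (s * (2 / (sigma * sigma))) with (2 * s / (sigma * sigma)) by (field; lra).
      exact H.
  - apply Rmult_le_reg_r with (r := sigma * sigma / 2); [lra|].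
    replace (2 * s / (sigma * sigma) * (sigma * sigma / 2)) with s by (field; lra).
    lra.
Qed.

Definition D_plus (sigma : R) (Phi : R -> R) (x : R) : R :=
  ln ((1 - G_plus sigma Phi (- x)) / (1 - G_minus sigma Phi (- x))).
Definition D_minus (sigma : R) (Phi : R -> R) (x : R) : R :=
  ln (G_plus sigma Phi (- x) / G_minus sigma Phi (- x)).

(** Action sequences: [a k = true] iff agent k+1 plays +1.
    [pub_llr a n] is the public log-likelihood ratio ell_{n+1}
    (so [pub_llr a 0] = ell_1 = 0). *)
Fixpoint pub_llr (sigma : R) (Phi : R -> R) (a : nat -> bool) (n : nat) : R :=
  match n with
  | O => 0
  | S m => let l := pub_llr sigma Phi a m in
           if a m then l + D_plus sigma Phi l else l + D_minus sigma Phi l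
  end.

(** Conditional on theta = +1, given history with public llr l,
    P_+(a = +1) = P_+(l + L > 0) = 1 - G_+(-l). *)
Definition act_prob (sigma : R) (Phi : R -> R) (b : bool) (l : R) : R :=
  if b then 1 - G_plus sigma Phi (- l) else G_plus sigma Phi (- l).

Fixpoint cyl_prob (sigma : R) (Phi : R -> R) (w : nat -> bool) (n : nat) : R :=
  match n with
  | O => 1
  | S m => cyl_prob sigma Phi w m * act_prob sigma Phi (w m) (pub_llr sigma Phi w m)
  end.

Definition in_cyl (w : nat -> bool) (n : nat) (a : nat -> bool) : Prop :=
  forall k, (k < n)%nat -> a k = w k.

(** A set of action sequences is P_+-null iff its outer measure (infimum of
    total mass of countable covers by cylinders) is 0; an event holds with
    probability 1 iff its complement is null. *)
Definition null_set (sigma : R) (Phi : R -> R) (N : (nat -> bool) -> Prop) : Prop :=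
  forall eps, 0 < eps ->
    exists (w : nat -> nat -> bool) (len : nat -> nat),
      (forall a, N a -> exists i, in_cyl (w i) (len i) a) /\
      (forall m, sum_f_R0 (fun i => cyl_prob sigma Phi (w i) (len i)) m <= eps).

Definition almost_surely (sigma : R) (Phi : R -> R) (E : (nat -> bool) -> Prop) : Prop :=
  null_set sigma Phi (fun a => ~ E a).

(* Main.v *)
(** With [u = sigma l / 2] and [c = 1 / sigma], a [+1] at public log-likelihood ratio [l] has
    [P_+]-probability [Phi (u + c)].  Under [P_+] the process [exp (- l_t)] is a
    martingale, and every action [-1] leaves the public log-likelihood ratio [<= 0].  The
    martingale is unlikely to ever exceed [e^M], and from any [l > - M] all later
    actions are [+1] with probability bounded away from [0]; hence almost surely only
    finitely many actions are [-1].  Along such a herd [u] follows the deterministic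
    recursion [u' = u + sigma D_+ / 2], whose increments are [exp (- u^2 / 2 (1 + o(1)))],
    so [u^2 / 2 ~ ln t].  Symmetry of [Phi] rests on [Phi 0 = 1 / 2], the Gaussian
    integral, obtained by differentiating [int_0^1 exp (- x^2 (1 + t^2) / 2) / (1 + t^2) dt]. *)

Require Import Defs.
From Stdlib Require Import Reals Lra Lia Psatz ClassicalEpsilon.
From Coquelicot Require Import Coquelicot.
Open Scope R_scope.

(* [ring] and [field] do not see through Coquelicot's carriers of [R]. *)
Ltac eq_in_R := match goal with |- @eq _ ?a ?b => change (@eq R a b) end.

(** * Elementary inequalities from calculus *)

Lemma mean_value (f df : R -> R) (a b : R) :
  (forall x, derivable_pt_lim f x (df x)) -> a <= b ->
  exists xi, a <= xi <= b /\ f b - f a = df xi * (b - a).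
Proof.
  intros Hf Hab.
  destruct (MVT_gen f a b df) as [xi Hxi].
  - intros x _. apply is_derive_Reals, Hf.
  - intros x _. apply derivable_continuous_pt. exists (df x). apply Hf.
  - rewrite Rmin_left, Rmax_right in Hxi by exact Hab. now exists xi.
Qed.

Lemma is_derive_null_const (f : R -> R) :
  (forall x, is_derive f x 0) -> forall x y, f x = f y.
Proof.
  intros Hf.
  assert (H : forall x y, x <= y -> f x = f y).
  { intros x y Hxy.
    destruct (mean_value f (fun _ => 0) x y) as [xi [_ E]]; [|exact Hxy|lra].
    intro z. apply is_derive_Reals, Hf. }
  intros x y. destruct (Rle_dec x y) as [L|L].
  - now apply H.
  - symmetry. apply H. lra.
Qed.

(** Convexity: [exp] lies above its tangent at [a]. The tangent at the left or at the right end of a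
    step yields lower or upper bounds on increments of an exponential. *)
Lemma exp_sub_ge (a b : R) : exp a * (b - a) <= exp b - exp a.
Proof.
  replace (exp b) with (exp a * exp (b - a)) by (rewrite <- exp_plus; f_equal; ring).
  pose proof (exp_pos a).
  assert (1 + (b - a) <= exp (b - a)) by apply exp_ineq1_le.
  nra.
Qed.

Lemma exp_le_mono (a b : R) : a <= b -> exp a <= exp b.
Proof.
  intros [H|H]; [left; now apply exp_increasing|right; now rewrite H].
Qed.

Lemma ln_le_sub_1 (x : R) : 0 < x -> ln x <= x - 1.
Proof.
  intros Hx. pose proof (exp_ineq1_le (ln x)). rewrite exp_ln in H by exact Hx. lra.
Qed.

(** * The Gaussian integral *)

Lemma gauss_density_pos (x : R) : 0 < gauss_density x.
Proof.
  unfold gauss_density. apply Rdiv_lt_0_compat; [apply exp_pos|].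
  apply sqrt_lt_R0. pose proof PI_RGT_0. lra.
Qed.

Lemma one_le_sqrt_2PI : 1 <= sqrt (2 * PI).
Proof.
  rewrite <- sqrt_1 at 1. apply sqrt_le_1_alt. pose proof PI2_1. unfold PI2 in H. lra.
Qed.

Lemma gauss_density_opp (x : R) : gauss_density (- x) = gauss_density x.
Proof. unfold gauss_density. do 3 f_equal. ring. Qed.

Lemma gauss_density_antitone (x y : R) :
  0 <= x -> x <= y -> gauss_density y <= gauss_density x.
Proof.
  intros Hx Hy. unfold gauss_density. apply Rmult_le_compat_r.
  - left. apply Rinv_0_lt_compat. pose proof one_le_sqrt_2PI. lra.
  - apply exp_le_mono. nra.
Qed.

(** Since [(y + c)^2 - (y - c)^2 = 4 y c], two shifted Gaussians differ by an exponential tilt. *)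
Lemma gauss_density_shift (c y : R) :
  exp (2 * y * c) * gauss_density (y + c) = gauss_density (y - c).
Proof.
  unfold gauss_density, Rdiv. rewrite <- Rmult_assoc, <- exp_plus.
  do 2 f_equal. field.
Qed.

(** The denominator cancels when differentiating in [x], leaving a product of Gaussians in [x] and
    in [x t]. *)
Definition gauss_kernel (x t : R) : R := exp (- (x * x) * (1 + t * t) / 2) / (1 + t * t).

Lemma gauss_kernel_derive (x t : R) :
  is_derive (fun z => gauss_kernel z t) x (- x * exp (- (x * x) * (1 + t * t) / 2)).
Proof.
  unfold gauss_kernel. auto_derive; [trivial|].
  unfold Rdiv. field. nra.
Qed.

Lemma gauss_kernel_continuous (x t : R) : continuous (gauss_kernel x) t.
Proof.
  apply (ex_derive_continuous (gauss_kernel x)).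
  unfold gauss_kernel. auto_derive. nra.
Qed.

Lemma ex_RInt_gauss_kernel (x : R) : ex_RInt (gauss_kernel x) 0 1.
Proof.
  apply (ex_RInt_continuous (V := R_CompleteNormedModule)).
  intros t _. apply gauss_kernel_continuous.
Qed.

Lemma RInt_gauss_kernel_0 : RInt (gauss_kernel 0) 0 1 = PI / 4.
Proof.
  rewrite <- atan_1. replace (atan 1) with (minus (atan 1) (atan 0))
    by (rewrite atan_0; unfold minus, plus, opp; simpl; ring).
  apply is_RInt_unique.
  apply (is_RInt_ext (fun t => / (1 + t²))).
  - intros t _. unfold gauss_kernel, Rsqr.
    replace (- (0 * 0) * (1 + t * t) / 2) with 0 by field.
    rewrite exp_0. eq_in_R. field. nra.
  - apply (is_RInt_derive atan).
    + intros t _. apply is_derive_atan.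
    + intros t _. apply (ex_derive_continuous (fun t => / (1 + t²))).
      unfold Rsqr. auto_derive. nra.
Qed.

Lemma RInt_gauss_kernel_bounds (x : R) :
  0 <= RInt (gauss_kernel x) 0 1 <= exp (- (x * x) / 2).
Proof.
  split.
  - apply RInt_ge_0; [lra|apply ex_RInt_gauss_kernel|].
    intros t _. unfold gauss_kernel. left. apply Rdiv_lt_0_compat; [apply exp_pos|nra].
  - apply Rle_trans with (RInt (fun _ => exp (- (x * x) / 2)) 0 1).
    + apply RInt_le; [lra|apply ex_RInt_gauss_kernel|apply ex_RInt_const|].
      intros t Ht. unfold gauss_kernel.
      apply Rle_trans with (exp (- (x * x) / 2) / 1); [|lra].
      unfold Rdiv at 1 3. apply Rmult_le_compat.
      * left; apply exp_pos.
      * left; apply Rinv_0_lt_compat; nra.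
      * apply exp_le_mono. nra.
      * apply Rinv_le_contravar; nra.
    + rewrite RInt_const. unfold scal; simpl; unfold mult; simpl. lra.
Qed.

(** * Positivity of [Phi] and its value at the origin *)

Section StandardNormal.

Variable Phi : R -> R.
Hypothesis Phi_cdf : is_std_normal_cdf Phi.

Lemma Phi_derive (x : R) : is_derive Phi x (gauss_density x).
Proof. apply is_derive_Reals, Phi_cdf. Qed.

Lemma Phi_mean_value (a b : R) : a <= b ->
  exists xi, a <= xi <= b /\ Phi b - Phi a = gauss_density xi * (b - a).
Proof. apply mean_value, Phi_cdf. Qed.

Lemma Phi_increasing (a b : R) : a < b -> Phi a < Phi b.
Proof.
  intros H. destruct (Phi_mean_value a b) as [xi [_ E]]; [lra|].
  pose proof (gauss_density_pos xi). nra.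
Qed.

Lemma Phi_monotone (a b : R) : a <= b -> Phi a <= Phi b.
Proof. intros [H| ->]; [left; now apply Phi_increasing|lra]. Qed.

(** If [Phi x <= 0], strict monotonicity keeps [Phi] below the negative number [Phi (x - 1)] further
    left, against the limit [0]. *)
Lemma Phi_pos (x : R) : 0 < Phi x.
Proof.
  destruct (Rlt_dec 0 (Phi x)) as [H|H]; [exact H|exfalso].
  pose proof (Phi_increasing (x - 1) x ltac:(lra)).
  destruct (proj2 Phi_cdf (- Phi (x - 1))) as [M HM]; [lra|].
  set (y := Rmin (x - 1) (M - 1)).
  assert (y <= x - 1) by apply Rmin_l. assert (y <= M - 1) by apply Rmin_r.
  specialize (HM y ltac:(lra)). pose proof (Phi_monotone y (x - 1) ltac:(lra)).
  pose proof (Rle_abs (- Phi y)). rewrite Rabs_Ropp in *. lra.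
Qed.

(** A nondecreasing function whose lower limit at minus infinity is at least [0] is nonnegative. The
    decay is measured by [Phi] itself, so the tail estimates below need no separate limit. *)
Lemma nonneg_of_monotone_at_minus_infty (f df : R -> R) (a b : R) :
  (forall x, derivable_pt_lim f x (df x)) ->
  (forall x, x <= b -> 0 <= df x) ->
  (forall x, x <= b -> - Phi (x + a) <= f x) ->
  forall y, y <= b -> 0 <= f y.
Proof.
  intros Hf Hdf Hlow y Hy.
  destruct (Rle_dec 0 (f y)) as [H|H]; [exact H|exfalso].
  destruct (proj2 Phi_cdf (- f y)) as [M HM]; [lra|].
  set (z := Rmin y (M - a - 1)).
  assert (z <= y) by apply Rmin_l. assert (z <= M - a - 1) by apply Rmin_r.
  specialize (HM (z + a) ltac:(lra)).
  pose proof (Rle_abs (Phi (z + a))). specialize (Hlow z ltac:(lra)).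
  destruct (mean_value f df z y Hf) as [xi [Hxi E]]; [lra|].
  specialize (Hdf xi ltac:(lra)). nra.
Qed.

(** Differentiate under the integral sign; the substitution [x t] then turns the Gaussian in [x t]
    into an increment of [Phi]. *)
Lemma gauss_derive_RInt (x : R) :
  is_derive (fun z => RInt (gauss_kernel z) 0 1) x
    (- (2 * PI) * gauss_density x * (Phi x - Phi 0)).
Proof.
  set (S := sqrt (2 * PI)).
  assert (HS : 0 < S) by (pose proof one_le_sqrt_2PI; unfold S; lra).
  assert (HSS : S * S = 2 * PI) by (apply sqrt_sqrt; pose proof PI_RGT_0; lra).
  assert (E : RInt (fun t => Derive (fun z => gauss_kernel z t) x) 0 1
              = - (2 * PI) * gauss_density x * (Phi x - Phi 0)).
  { apply is_RInt_unique.
    apply (is_RInt_ext (fun t => scal (- (2 * PI) * gauss_density x)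
                                   (scal x (gauss_density (x * t + 0))))).
    - intros t _. symmetry.
      etransitivity; [apply is_derive_unique, gauss_kernel_derive|].
      unfold scal; simpl; unfold mult; simpl. unfold gauss_density. fold S.
      rewrite <- HSS.
      replace (- (x * x) * (1 + t * t) / 2) with (- (x * x) / 2 + - ((x * t + 0) * (x * t + 0)) / 2) by field.
      rewrite exp_plus. eq_in_R. field. lra.
    - apply (is_RInt_scal (V := R_NormedModule)), (is_RInt_comp_lin (V := R_NormedModule)).
      replace (x * 0 + 0) with 0 by ring. replace (x * 1 + 0) with x by ring.
      apply (is_RInt_derive Phi).
      + intros t _. apply Phi_derive.
      + intros t _. apply (ex_derive_continuous gauss_density).
        unfold gauss_density. auto_derive. fold S. lra. }
  rewrite <- E. apply is_derive_RInt_param.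
  - apply filter_forall. intros y t _. eexists. apply gauss_kernel_derive.
  - intros t _. apply continuity_2d_pt_ext with
      (fun u v => - u * exp (- (u * u) * (1 + v * v) / 2)).
    + intros u v. symmetry. apply is_derive_unique, gauss_kernel_derive.
    + apply continuity_2d_pt_mult.
      * apply continuity_2d_pt_opp, continuity_2d_pt_id1.
      * apply (continuity_1d_2d_pt_comp exp).
        { apply derivable_continuous_pt, derivable_pt_exp. }
        unfold Rdiv.
        apply continuity_2d_pt_mult; [|apply continuity_2d_pt_const].
        apply continuity_2d_pt_mult.
        -- apply continuity_2d_pt_opp, continuity_2d_pt_mult; apply continuity_2d_pt_id1.
        -- apply continuity_2d_pt_plus; [apply continuity_2d_pt_const|].
           apply continuity_2d_pt_mult; apply continuity_2d_pt_id2.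
  - apply filter_forall. intros y. apply ex_RInt_gauss_kernel.
Qed.

(** The derivatives of the two summands cancel, and at [0] the left side is [(PI / 4) / PI]. *)
Lemma gauss_integral_identity (x : R) :
  (Phi x - Phi 0) * (Phi x - Phi 0) + RInt (gauss_kernel x) 0 1 / PI = 1 / 4.
Proof.
  pose proof PI_RGT_0 as HPI.
  transitivity ((Phi 0 - Phi 0) * (Phi 0 - Phi 0) + RInt (gauss_kernel 0) 0 1 / PI).
  - apply (is_derive_null_const
             (fun x => (Phi x - Phi 0) * (Phi x - Phi 0) + RInt (gauss_kernel x) 0 1 / PI)).
    intros z.
    apply (is_derive_ext (fun x => (Phi x - Phi 0) * (Phi x - Phi 0)
                                    + / PI * RInt (gauss_kernel x) 0 1)).
    { intros t. eq_in_R. unfold Rdiv. ring. }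
    evar_last.
    + apply (is_derive_plus (V := R_NormedModule)).
      * apply (is_derive_mult (fun x => Phi x - Phi 0) (fun x => Phi x - Phi 0));
          [| |intros; apply Rmult_comm];
          (apply (is_derive_minus (V := R_NormedModule));
           [apply Phi_derive|apply (is_derive_const (V := R_NormedModule))]).
      * apply (is_derive_scal (fun x => RInt (gauss_kernel x) 0 1)), gauss_derive_RInt.
    + unfold minus, plus, mult, opp, zero; simpl. eq_in_R. field. lra.
  - rewrite RInt_gauss_kernel_0. field. lra.
Qed.

(** Letting [x] tend to minus infinity in the identity leaves [Phi 0 ^ 2 = 1 / 4], and positivity
    selects the root. *)
Lemma Phi_0 : Phi 0 = 1 / 2.
Proof.
  pose proof PI_RGT_0 as HPI. pose proof (Phi_pos 0) as H0.
  cut (Phi 0 * Phi 0 = 1 / 4); [nra|].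
  apply cond_eq. intros eps Heps.
  (* This threshold makes the terms containing [Phi x] in the expanded square smaller than
     [eps / 2]. *)
  destruct (proj2 Phi_cdf (Rmin 1 (eps / (2 * (2 * Phi 0 + 1))))) as [M HM].
  { apply Rmin_glb_lt; [lra|]. apply Rdiv_lt_0_compat; lra. }
  (* The second bound gives [x * x >= 4 / eps], hence an integral below [eps / 2]. *)
  set (x := Rmin (M - 1) (- (1 + 4 / eps))).
  assert (Hx1 : x <= M - 1) by apply Rmin_l.
  assert (Hx2 : x <= - (1 + 4 / eps)) by apply Rmin_r.
  specialize (HM x ltac:(lra)).
  pose proof (Phi_pos x) as Hp. rewrite Rabs_right in HM by lra.
  assert (Hb1 : Phi x < 1) by (eapply Rlt_le_trans; [exact HM|apply Rmin_l]).
  assert (Hb2 : Phi x * (2 * Phi 0 + 1) < eps / 2).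
  { apply Rlt_le_trans with (eps / (2 * (2 * Phi 0 + 1)) * (2 * Phi 0 + 1)).
    - apply Rmult_lt_compat_r; [lra|]. eapply Rlt_le_trans; [exact HM|apply Rmin_r].
    - right. field. lra. }
  pose proof (gauss_integral_identity x) as HI.
  pose proof (RInt_gauss_kernel_bounds x) as [HB1 HB2].
  set (I := RInt (gauss_kernel x) 0 1) in *.
  assert (Hexp : exp (- (x * x) / 2) < eps / 2).
  { assert (H4 : 0 < 4 / eps) by (apply Rdiv_lt_0_compat; lra).
    assert (Hlow : 2 / eps < exp (x * x / 2)).
    { pose proof (exp_ineq1_le (x * x / 2)).
      assert (x * x >= 4 / eps) by nra.
      replace (2 / eps) with (4 / eps / 2) by (field; lra). lra. }
    replace (- (x * x) / 2) with (- (x * x / 2)) by field. rewrite exp_Ropp.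
    replace (eps / 2) with (/ (2 / eps)) by (field; lra).
    apply Rinv_lt_contravar; [|exact Hlow].
    apply Rmult_lt_0_compat; [apply Rdiv_lt_0_compat; lra|apply exp_pos]. }
  assert (HIP : 0 <= I / PI <= I).
  { pose proof PI2_1 as H1. unfold PI2 in H1. split.
    - apply Rmult_le_pos; [lra|left; apply Rinv_0_lt_compat; lra].
    - apply Rmult_le_reg_r with PI; [lra|]. unfold Rdiv.
      rewrite Rmult_assoc, Rinv_l by lra. nra. }
  apply Rabs_def1; nra.
Qed.

(** * Symmetry, tails and increments of [Phi] *)

Lemma Phi_opp (x : R) : Phi (- x) = 1 - Phi x.
Proof.
  cut (Phi x + Phi (- x) = Phi 0 + Phi (- 0)).
  { rewrite Ropp_0, Phi_0. lra. }
  apply (is_derive_null_const (fun x => Phi x + Phi (- x))).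
  intros z. replace 0 with (plus (gauss_density z) (scal (- (1)) (gauss_density (- z)))).
  - apply (is_derive_plus (V := R_NormedModule)); [apply Phi_derive|].
    apply (is_derive_comp Phi Ropp); [apply Phi_derive|].
    auto_derive; [trivial|ring].
  - rewrite gauss_density_opp. unfold plus, scal; simpl; unfold mult; simpl. eq_in_R. ring.
Qed.

Lemma Phi_lt_1 (x : R) : Phi x < 1.
Proof. pose proof (Phi_pos (- x)). rewrite Phi_opp in H. lra. Qed.

(** For [y <= -1] the right side grows at least as fast as [Phi], because [- y >= 1] and the
    normalising constant is at least [1]. *)
Lemma Phi_le_exp (y : R) : y <= -1 -> Phi y <= exp (- (y * y) / 2).
Proof.
  intros Hy. cut (0 <= exp (- (y * y) / 2) - Phi y); [lra|].
  pose proof one_le_sqrt_2PI as HS.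
  apply (nonneg_of_monotone_at_minus_infty (fun y => exp (- (y * y) / 2) - Phi y)
    (fun y => - y * exp (- (y * y) / 2) - gauss_density y) 0 (-1)); [| | |exact Hy].
  - intros x. apply derivable_pt_lim_minus; [|apply Phi_cdf].
    apply is_derive_Reals. auto_derive; [trivial|unfold Rdiv; field].
  - intros x Hx. unfold gauss_density. pose proof (exp_pos (- (x * x) / 2)).
    assert (/ sqrt (2 * PI) <= 1) by (rewrite <- Rinv_1; apply Rinv_le_contravar; lra).
    unfold Rdiv. nra.
  - intros x _. rewrite Rplus_0_r. pose proof (exp_pos (- (x * x) / 2)). lra.
Qed.

(* The right side minus the left side has derivative [2 c e^{2 y c} Phi (y + c) >= 0]. *)
Lemma Phi_shift_le (c y : R) : 0 <= c -> Phi (y - c) <= exp (2 * y * c) * Phi (y + c).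
Proof.
  intros Hc. cut (0 <= exp (2 * y * c) * Phi (y + c) - Phi (y - c)); [lra|].
  apply (nonneg_of_monotone_at_minus_infty
    (fun y => exp (2 * y * c) * Phi (y + c) - Phi (y - c))
    (fun y => 2 * c * exp (2 * y * c) * Phi (y + c)) (- c) y); [| | |lra].
  - intros x. apply is_derive_Reals.
    evar_last.
    + apply (is_derive_minus (V := R_NormedModule)).
      * apply (is_derive_mult (fun y => exp (2 * y * c)) (fun y => Phi (y + c))).
        -- auto_derive; [trivial|reflexivity].
        -- apply (is_derive_comp Phi (fun y => y + c)); [apply Phi_derive|].
           auto_derive; [trivial|reflexivity].
        -- intros; apply Rmult_comm.
      * apply (is_derive_comp Phi (fun y => y - c)); [apply Phi_derive|].
        auto_derive; [trivial|reflexivity].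
    + pose proof (gauss_density_shift c x) as Hs.
      unfold minus, plus, opp, scal, mult; simpl; unfold mult; simpl.
      rewrite <- Hs. eq_in_R. ring.
  - intros x _. pose proof (exp_pos (2 * x * c)). pose proof (Phi_pos (x + c)).
    assert (0 <= exp (2 * x * c) * Phi (x + c)) by nra. nra.
  - intros x _. change (x - c) with (x + - c). pose proof (exp_pos (2 * x * c)).
    pose proof (Phi_pos (x + c)). nra.
Qed.

(** Points between [u - c] and [u + c] have modulus at most [Rabs u + c], and the density decreases
    in the modulus. *)
Lemma Phi_increment_ge (c u : R) : 0 <= c ->
  2 * c * gauss_density (Rabs u + c) <= Phi (u + c) - Phi (u - c).
Proof.
  intros Hc. destruct (Phi_mean_value (u - c) (u + c)) as [xi [Hxi E]]; [lra|].
  rewrite E. replace (u + c - (u - c)) with (2 * c) by ring.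
  rewrite Rmult_comm. apply Rmult_le_compat_r; [lra|].
  replace (gauss_density xi) with (gauss_density (Rabs xi)).
  - apply gauss_density_antitone; [apply Rabs_pos|].
    unfold Rabs; destruct (Rcase_abs xi), (Rcase_abs u); lra.
  - unfold Rabs; destruct (Rcase_abs xi); [apply gauss_density_opp|reflexivity].
Qed.

End StandardNormal.

(** * The deterministic recursion along a herd *)

(** The bound is the maximum of the parabola, attained at [u = b / q]; it absorbs linear terms in
    the exponents of the growth estimates. *)
Lemma complete_square_bound (q b u : R) : 0 < q -> b * u - q / 2 * (u * u) <= b * b / (2 * q).
Proof.
  intros Hq. apply Rmult_le_reg_r with (2 * q); [lra|].
  replace (b * b / (2 * q) * (2 * q)) with (b * b) by (field; lra).
  pose proof (Rle_0_sqr (q * u - b)). unfold Rsqr in *. nra.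
Qed.

Lemma iterate_increment_ge (f : nat -> R) (C : R) (n : nat) :
  (forall k, (n <= k)%nat -> C <= f (S k) - f k) ->
  forall k, f n + C * INR k <= f (n + k)%nat.
Proof.
  intros H. induction k as [|k IH].
  - rewrite Nat.add_0_r. simpl. lra.
  - rewrite Nat.add_succ_r, S_INR. specialize (H (n + k)%nat ltac:(lia)). lra.
Qed.

Section Herd.

(** In the application [u n] is [sigma / 2] times the public log-likelihood ratio, [c = / sigma],
    [s = sigma], and all actions from [N] on are [+1]. *)
Variables (c s : R) (u : nat -> R) (N : nat).
Hypothesis c_pos : 0 < c.
Hypothesis s_pos : 0 < s.
Hypothesis increment_ge : forall n, (N <= n)%nat ->
  gauss_density (Rabs (u n) + c) <= u (S n) - u n.
Hypothesis increment_le : forall n, (N <= n)%nat -> c + 1 <= u n ->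
  u (S n) - u n <= s * exp (- ((u n - c) * (u n - c)) / 2).

Lemma herd_increasing (n m : nat) : (N <= n)%nat -> (n <= m)%nat -> u n <= u m.
Proof.
  intros Hn. induction 1 as [|m Hm IH]; [lra|].
  pose proof (increment_ge m ltac:(lia)). pose proof (gauss_density_pos (Rabs (u m) + c)). lra.
Qed.

(** If [u] stayed below [B], monotonicity would confine it to a bounded interval, where the
    increments are at least a fixed [d > 0]. *)
Lemma herd_diverges (B : R) : exists n1, (N <= n1)%nat /\ forall n, (n1 <= n)%nat -> B <= u n.
Proof.
  destruct (classic (exists n, (N <= n)%nat /\ B <= u n)) as [[n [Hn Hu]]|H].
  - exists n. split; [exact Hn|]. intros m Hm. pose proof (herd_increasing n m Hn Hm). lra.
  - exfalso.
    assert (Hlt : forall n, (N <= n)%nat -> u n < B).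
    { intros n Hn. apply Rnot_le_lt. intro. apply H. now exists n. }
    set (b := Rmax B (- u N)).
    pose proof (Rmax_l B (- u N)) as Hb1. pose proof (Rmax_r B (- u N)) as Hb2. fold b in Hb1, Hb2.
    set (d := gauss_density (b + c)). pose proof (gauss_density_pos (b + c)) as Hd. fold d in Hd.
    assert (Hinc : forall k, (N <= k)%nat -> d <= u (S k) - u k).
    { intros k Hk. eapply Rle_trans; [|apply increment_ge; exact Hk].
      apply gauss_density_antitone; [pose proof (Rabs_pos (u k)); lra|].
      apply Rplus_le_compat_r, Rabs_le.
      pose proof (Hlt k Hk). pose proof (herd_increasing N k (le_n N) Hk). lra. }
    destruct (INR_unbounded ((B - u N) / d)) as [k Hk].
    pose proof (iterate_increment_ge u d N Hinc k). pose proof (Hlt (N + k)%nat ltac:(lia)).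
    apply Rmult_gt_compat_r with (r := d) in Hk; [|lra].
    replace ((B - u N) / d * d) with (B - u N) in Hk by (field; lra). lra.
Qed.

(* [exp (u^2 / (2 lambda))] grows at most linearly for [lambda > 1] and at least
   linearly for [lambda < 1], since [u] moves by about [exp (- u^2 / 2)]. *)
Lemma herd_upper (lambda : R) : 1 < lambda ->
  exists C n1, forall n, (n1 <= n)%nat -> u n * u n / 2 <= lambda * ln (INR (S n)) + C.
Proof.
  intros Hl. set (kap := / lambda).
  assert (Hkl : kap * lambda = 1) by (unfold kap; field; lra).
  assert (Hk : 0 < kap < 1).
  { split; [apply Rinv_0_lt_compat; lra|]. rewrite <- Rinv_1. apply Rinv_lt_contravar; lra. }
  destruct (herd_diverges (c + 1)) as [n1 [Hn1 Hu]].
  set (f := fun n => exp (kap * (u n * u n) / 2)).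
  (* [C1] bounds one increment of the exponent: [- (v - c)^2 / 2 + v] is maximal at [v = c + 1]. *)
  set (C1 := s * exp (1 / 2 + c + s)).
  (* [Q] comes from completing the square in [(c + 1) v - (1 - kap) v^2 / 2]; it is finite because
     [kap < 1]. *)
  set (Q := (c + 1) * (c + 1) / (2 * (1 - kap)) + s).
  set (C := exp C1 * (s * exp Q)).
  assert (HC : 0 < C).
  { unfold C. apply Rmult_lt_0_compat; [apply exp_pos|].
    apply Rmult_lt_0_compat; [exact s_pos|apply exp_pos]. }
  (* The signs let the iteration of lower bounds produce an upper bound on [f]. *)
  assert (Hf : forall n, (n1 <= n)%nat -> - C <= - f (S n) - - f n).
  { intros n Hn. specialize (Hu n Hn).
    pose proof (increment_le n ltac:(lia) Hu) as Hd.
    pose proof (herd_increasing n (S n) ltac:(lia) ltac:(lia)) as Hd0.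
    set (v := u n) in *. set (d := u (S n) - v) in *.
    assert (Hd0' : 0 <= d) by (unfold d; lra).
    assert (Hv' : u (S n) = v + d) by (unfold d; ring).
    unfold f. rewrite Hv'. fold v.
    set (x := kap * (v * v) / 2). set (y := kap * ((v + d) * (v + d)) / 2).
    set (e := exp (- ((v - c) * (v - c)) / 2)) in *.
    assert (He : 0 < e <= 1).
    { split; [apply exp_pos|]. rewrite <- exp_0. apply exp_le_mono.
      pose proof (Rle_0_sqr (v - c)). unfold Rsqr in *. lra. }
    assert (Hds : d <= s) by nra.
    assert (Hxy : y - x <= s * (e * exp (v + s))).
    { apply Rle_trans with (d * (v + d)).
      - replace (y - x) with (kap * (d * (v + d / 2))) by (unfold x, y; field).
        assert (0 <= d * (v + d / 2) <= d * (v + d)) by (split; nra).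
        nra.
      - apply Rle_trans with (s * e * (v + s)).
        + apply Rmult_le_compat; lra.
        + rewrite <- Rmult_assoc. apply Rmult_le_compat_l; [nra|].
          pose proof (exp_ineq1_le (v + s)). lra. }
    assert (Hxy1 : y - x <= C1).
    { eapply Rle_trans; [exact Hxy|]. unfold C1, e. rewrite <- exp_plus.
      apply Rmult_le_compat_l; [lra|]. apply exp_le_mono.
      pose proof (Rle_0_sqr (v - c - 1)). unfold Rsqr in *. lra. }
    pose proof (exp_sub_ge y x) as Hexp.
    cut (exp y * (y - x) <= C); [lra|].
    apply Rle_trans with (exp (x + C1) * (s * (e * exp (v + s)))).
    - apply Rle_trans with (exp y * (s * (e * exp (v + s)))).
      + apply Rmult_le_compat_l; [left; apply exp_pos|exact Hxy].
      + apply Rmult_le_compat_r; [|apply exp_le_mono; lra].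
        pose proof (exp_pos (v + s)). apply Rmult_le_pos; [lra|]. apply Rmult_le_pos; lra.
    - unfold C, e.
      replace (exp (x + C1) * (s * (exp (- ((v - c) * (v - c)) / 2) * exp (v + s))))
        with (exp C1 * (s * exp (x + (- ((v - c) * (v - c)) / 2 + (v + s)))))
        by (rewrite !exp_plus; ring).
      apply Rmult_le_compat_l; [left; apply exp_pos|].
      apply Rmult_le_compat_l; [lra|]. apply exp_le_mono. unfold x, Q.
      pose proof (complete_square_bound (1 - kap) (c + 1) v ltac:(lra)). nra. }
  exists (lambda * ln (f n1 + C)), n1. intros n Hn.
  pose proof (iterate_increment_ge (fun n => - f n) (- C) n1 Hf (n - n1)) as Hit.
  replace (n1 + (n - n1))%nat with n in Hit by lia.
  assert (HfN : 0 < f n1) by apply exp_pos.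
  assert (HS : 1 <= INR (S n)) by (rewrite S_INR; pose proof (pos_INR n); lra).
  assert (HI : INR (n - n1) <= INR (S n)) by (apply le_INR; lia).
  assert (Hle : f n <= (f n1 + C) * INR (S n)) by nra.
  assert (Hln : ln (f n) <= ln (f n1 + C) + ln (INR (S n))).
  { rewrite <- ln_mult by lra. apply ln_le; [apply exp_pos|exact Hle]. }
  unfold f at 1 in Hln. rewrite ln_exp in Hln.
  apply Rmult_le_compat_l with (r := lambda) in Hln; [|lra].
  replace (lambda * (kap * (u n * u n) / 2)) with (kap * lambda * (u n * u n / 2)) in Hln by field.
  rewrite Hkl in Hln. lra.
Qed.

Lemma herd_lower (lambda : R) : 0 < lambda < 1 ->
  exists C n1, forall n, (n1 <= n)%nat -> lambda * ln (INR (S n)) - C <= u n * u n / 2.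
Proof.
  intros Hl. set (kap := / lambda).
  assert (Hkl : kap * lambda = 1) by (unfold kap; field; lra).
  assert (Hk : 1 < kap) by (rewrite <- Rinv_1; apply Rinv_lt_contravar; lra).
  (* Once [u >= 1], the increment of [u^2 / 2] is at least that of [u]. *)
  destruct (herd_diverges 1) as [n1 [Hn1 Hu]].
  set (f := fun n => exp (kap * (u n * u n) / 2)).
  (* The exponent is the minimum over [v] of [kap v^2 / 2 - (v + c)^2 / 2], which exists because
     [kap > 1]. *)
  set (C := exp (- (c * c / (2 * (kap - 1))) - c * c / 2) / sqrt (2 * PI)).
  assert (HC : 0 < C).
  { apply Rdiv_lt_0_compat; [apply exp_pos|]. pose proof one_le_sqrt_2PI. lra. }
  assert (Hf : forall n, (n1 <= n)%nat -> C <= f (S n) - f n).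
  { intros n Hn. specialize (Hu n Hn).
    pose proof (increment_ge n ltac:(lia)) as Hd.
    rewrite Rabs_right in Hd by lra.
    set (v := u n) in *. set (d := u (S n) - v) in *.
    assert (Hv' : u (S n) = v + d) by (unfold d; ring).
    unfold f. rewrite Hv'. fold v.
    set (x := kap * (v * v) / 2). set (y := kap * ((v + d) * (v + d)) / 2).
    pose proof (gauss_density_pos (v + c)) as Hg.
    eapply Rle_trans; [|apply exp_sub_ge].
    apply Rle_trans with (exp x * gauss_density (v + c)).
    - unfold C, gauss_density, Rdiv. rewrite <- Rmult_assoc, <- exp_plus.
      apply Rmult_le_compat_r.
      + left. apply Rinv_0_lt_compat. pose proof one_le_sqrt_2PI. lra.
      + apply exp_le_mono. unfold x.
        pose proof (complete_square_bound (kap - 1) c v ltac:(lra)). unfold Rdiv in *. nra.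
    - apply Rmult_le_compat_l; [left; apply exp_pos|].
      apply Rle_trans with d; [exact Hd|].
      replace (y - x) with (kap * (d * (v + d / 2))) by (unfold x, y; field).
      assert (d <= d * (v + d / 2)) by nra. nra. }
  (* Starting after [2 * n1] ensures [S n <= 2 (n - n1)], whence the constant [C / 2]. *)
  exists (- (lambda * ln (C / 2))), (S (2 * n1)). intros n Hn.
  pose proof (iterate_increment_ge f C n1 Hf (n - n1)) as Hit.
  replace (n1 + (n - n1))%nat with n in Hit by lia.
  assert (HfN : 0 < f n1) by apply exp_pos.
  assert (HS : 1 <= INR (S n)) by (rewrite S_INR; pose proof (pos_INR n); lra).
  assert (HI : INR (S n) <= 2 * INR (n - n1)).
  { change 2 with (INR 2). rewrite <- mult_INR. apply le_INR. lia. }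
  assert (Hle : C / 2 * INR (S n) <= f n) by nra.
  assert (Hln : ln (C / 2) + ln (INR (S n)) <= ln (f n)).
  { rewrite <- ln_mult by lra. apply ln_le; [nra|exact Hle]. }
  unfold f in Hln. rewrite ln_exp in Hln.
  apply Rmult_le_compat_l with (r := lambda) in Hln; [|lra].
  replace (lambda * (kap * (u n * u n) / 2)) with (kap * lambda * (u n * u n / 2)) in Hln by field.
  rewrite Hkl in Hln. lra.
Qed.

(** The square of the ratio is [u^2 / 2] over [ln (n + 1)]. Taking [lambda = 1 + e / 2] and
    [1 - e / 2], with the additive constants absorbed for large [n], traps it between [1 - e] and
    [1 + e]. *)
Lemma herd_asymptotics :
  Un_cv (fun n => u n / (sqrt 2 * sqrt (ln (INR (S n))))) 1.
Proof.
  intros eps Heps. set (e := Rmin eps 1).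
  assert (He : 0 < e <= eps /\ e <= 1).
  { unfold e. pose proof (Rmin_l eps 1). pose proof (Rmin_r eps 1).
    pose proof (Rmin_glb_lt eps 1 0 ltac:(lra) ltac:(lra)). lra. }
  destruct (herd_upper (1 + e / 2) ltac:(lra)) as [C1 [m1 H1]].
  destruct (herd_lower (1 - e / 2) ltac:(lra)) as [C2 [m2 H2]].
  destruct (herd_diverges 0) as [m3 [_ H3]].
  set (B := Rmax 0 (Rmax (2 * C1 / e) (2 * C2 / e))).
  destruct (INR_unbounded (exp B)) as [m4 H4].
  exists (m1 + m2 + m3 + m4)%nat. intros n Hn.
  specialize (H1 n ltac:(lia)). specialize (H2 n ltac:(lia)). specialize (H3 n ltac:(lia)).
  set (L := ln (INR (S n))) in *.
  assert (HL : B < L).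
  { unfold L. rewrite <- (ln_exp B). apply ln_increasing; [apply exp_pos|].
    eapply Rlt_le_trans; [exact H4|]. apply le_INR. lia. }
  assert (HB0 : 0 <= B) by apply Rmax_l.
  assert (HBm : Rmax (2 * C1 / e) (2 * C2 / e) <= B) by apply Rmax_r.
  pose proof (Rmax_l (2 * C1 / e) (2 * C2 / e)). pose proof (Rmax_r (2 * C1 / e) (2 * C2 / e)).
  assert (HC : forall C, 2 * C / e <= B -> C < e / 2 * L).
  { intros C HCB. apply Rle_lt_trans with (e / 2 * (2 * C / e)); [right; field; lra|].
    apply Rmult_lt_compat_l; lra. }
  pose proof (HC C1 ltac:(lra)) as HC1. pose proof (HC C2 ltac:(lra)) as HC2.
  set (r := u n / (sqrt 2 * sqrt L)).
  assert (Hs2 : 0 < sqrt 2) by (apply sqrt_lt_R0; lra).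
  assert (HsL : 0 < sqrt L) by (apply sqrt_lt_R0; lra).
  assert (Hr0 : 0 <= r).
  { apply Rmult_le_pos; [lra|]. left. apply Rinv_0_lt_compat. nra. }
  assert (Hr2 : r * r * L = u n * u n / 2).
  { unfold r. replace (u n / (sqrt 2 * sqrt L) * (u n / (sqrt 2 * sqrt L)))
      with (u n * u n / ((sqrt 2 * sqrt 2) * (sqrt L * sqrt L))) by (field; lra).
    rewrite !sqrt_sqrt by lra. field. lra. }
  assert (Hup : r * r < 1 + e) by nra.
  assert (Hlow : 1 - e < r * r) by nra.
  unfold R_dist. apply Rabs_def1; nra.
Qed.

End Herd.

(** * Null sets from stopping rules *)

(** Unlike in [sum_f_R0], the upper index is excluded, so sums over full levels of [2 ^ n] words
    concatenate without shifts. *)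
Fixpoint Rsum (f : nat -> R) (n : nat) : R :=
  match n with
  | O => 0
  | S m => Rsum f m + f m
  end.

Lemma sum_f_R0_Rsum (f : nat -> R) (m : nat) : sum_f_R0 f m = Rsum f (S m).
Proof. induction m as [|m IH]; simpl in *; [ring|now rewrite IH]. Qed.

Lemma Rsum_add (f : nat -> R) (n m : nat) :
  Rsum f (n + m) = Rsum f n + Rsum (fun i => f (n + i)%nat) m.
Proof.
  induction m as [|m IH]; simpl.
  - rewrite Nat.add_0_r. ring.
  - rewrite Nat.add_succ_r. simpl. rewrite IH. ring.
Qed.

Lemma Rsum_le (f g : nat -> R) (n : nat) :
  (forall i, (i < n)%nat -> f i <= g i) -> Rsum f n <= Rsum g n.
Proof.
  induction n as [|n IH]; simpl; intros H; [lra|].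
  pose proof (H n ltac:(lia)). pose proof (IH ltac:(intros; apply H; lia)). lra.
Qed.

Lemma Rsum_ext (f g : nat -> R) (n : nat) :
  (forall i, (i < n)%nat -> f i = g i) -> Rsum f n = Rsum g n.
Proof.
  intros H. apply Rle_antisym; apply Rsum_le; intros i Hi; rewrite H by exact Hi; lra.
Qed.

Lemma Rsum_plus (f g : nat -> R) (n : nat) :
  Rsum (fun i => f i + g i) n = Rsum f n + Rsum g n.
Proof. induction n as [|n IH]; simpl; [ring|rewrite IH; ring]. Qed.

Lemma Rsum_monotone (f : nat -> R) (n m : nat) :
  (forall i, 0 <= f i) -> (n <= m)%nat -> Rsum f n <= Rsum f m.
Proof.
  intros Hf. induction 1; simpl; [lra|]. pose proof (Hf m). lra.
Qed.

Lemma Rsum_half_pow (n : nat) : Rsum (fun i => (1 / 2) ^ S i) n <= 1.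
Proof.
  cut (Rsum (fun i => (1 / 2) ^ S i) n = 1 - (1 / 2) ^ n).
  { intros ->. pose proof (pow_lt (1 / 2) n). lra. }
  induction n as [|n IH]; [simpl; ring|].
  change (Rsum (fun i => (1 / 2) ^ S i) n + (1 / 2) ^ S n = 1 - (1 / 2) ^ S n).
  rewrite IH. simpl. field.
Qed.

(** * Finite words of actions and their enumeration by binary digits *)

Definition extend (w : nat -> bool) (n : nat) (b : bool) : nat -> bool :=
  fun k => if Nat.eqb k n then b else w k.

Lemma extend_cyl (w : nat -> bool) (n : nat) (b : bool) : in_cyl w n (extend w n b).
Proof.
  intros k Hk. unfold extend. destruct (Nat.eqb_spec k n); [lia|reflexivity].
Qed.

Lemma extend_at (w : nat -> bool) (n : nat) (b : bool) : extend w n b n = b.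
Proof. unfold extend. now rewrite Nat.eqb_refl. Qed.

Definition adapted {T : Type} (f : (nat -> bool) -> nat -> T) : Prop :=
  forall n w w', in_cyl w n w' -> f w' n = f w n.

(* The binary expansions of [r < 2 ^ n] enumerate the words of length [n]. *)
Definition level_sum (f : (nat -> bool) -> nat -> R) (n : nat) : R :=
  Rsum (fun r => f (Nat.testbit r) n) (2 ^ n).

Lemma testbit_small (r n : nat) : (r < 2 ^ n)%nat -> Nat.testbit r n = false.
Proof.
  intros H. rewrite Nat.testbit_eqb, Nat.div_small by exact H. reflexivity.
Qed.

Lemma testbit_low_cyl (r n : nat) :
  (r < 2 ^ n)%nat -> in_cyl (Nat.testbit r) n (Nat.testbit (2 ^ n + r)).
Proof.
  intros H k Hk. rewrite <- (Nat.mod_pow2_bits_low (2 ^ n + r) n k Hk).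
  f_equal. rewrite Nat.add_comm. rewrite <- (Nat.mul_1_l (2 ^ n)) at 1.
  rewrite Nat.Div0.mod_add. now apply Nat.mod_small.
Qed.

Lemma testbit_high (r n : nat) : (r < 2 ^ n)%nat -> Nat.testbit (2 ^ n + r) n = true.
Proof.
  intros H. rewrite Nat.testbit_eqb. rewrite <- (Nat.mul_1_l (2 ^ n)) at 1.
  rewrite Nat.div_add_l by (apply Nat.pow_nonzero; lia).
  rewrite Nat.div_small by exact H. reflexivity.
Qed.

Lemma testbit_prefix (a : nat -> bool) (n : nat) :
  exists r, (r < 2 ^ n)%nat /\ in_cyl (Nat.testbit r) n a.
Proof.
  induction n as [|n [r [Hr Hc]]].
  - exists 0%nat. split; [simpl; lia|]. intros k Hk. lia.
  - destruct (a n) eqn:E.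
    + exists (2 ^ n + r)%nat. split; [simpl; lia|].
      intros k Hk. destruct (Nat.eq_dec k n) as [->|].
      * now rewrite testbit_high.
      * rewrite testbit_low_cyl by lia. apply Hc. lia.
    + exists r. split; [simpl; lia|].
      intros k Hk. destruct (Nat.eq_dec k n) as [->|].
      * now rewrite testbit_small.
      * apply Hc. lia.
Qed.

(** The codes [r] and [2 ^ n + r] extend the word of [r] by [false] and by [true]. *)
Lemma level_sum_succ (f : (nat -> bool) -> nat -> R) (n : nat) :
  adapted f ->
  level_sum f (S n) =
  level_sum (fun w n => f (extend w n false) (S n) + f (extend w n true) (S n)) n.
Proof.
  intros Hf. unfold level_sum. replace (2 ^ S n)%nat with (2 ^ n + 2 ^ n)%nat by (simpl; lia).
  rewrite Rsum_add, <- Rsum_plus. apply Rsum_ext. intros r Hr.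
  f_equal; apply Hf; intros k Hk; unfold extend;
    destruct (Nat.eqb_spec k n) as [->|].
  - now apply testbit_small.
  - reflexivity.
  - now apply testbit_high.
  - apply testbit_low_cyl; [exact Hr|lia].
Qed.

(** Optional stopping at a finite horizon: at each level the newly stopped mass [s] is paid for by
    the decrease of the total potential [U], and the sum telescopes. *)
Lemma level_sum_stopped (s U : (nat -> bool) -> nat -> R) (n : nat) :
  adapted s -> adapted U ->
  (forall w n, s (extend w n false) (S n) + U (extend w n false) (S n)
             + (s (extend w n true) (S n) + U (extend w n true) (S n)) <= U w n) ->
  Rsum (fun j => level_sum s (S j)) n + level_sum U n <= U (Nat.testbit 0) 0%nat.
Proof.
  intros Hs HU Hsup. induction n as [|n IH].
  - unfold level_sum. simpl. lra.
  - change (Rsum (fun j => level_sum s (S j)) (S n)) with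
      (Rsum (fun j => level_sum s (S j)) n + level_sum s (S n)).
    cut (level_sum s (S n) + level_sum U (S n) <= level_sum U n); [lra|].
    rewrite !level_sum_succ by assumption. unfold level_sum.
    rewrite <- Rsum_plus. apply Rsum_le. intros r _.
    specialize (Hsup (Nat.testbit r) n). lra.
Qed.

(** The index [2 ^ n + r] with [r < 2 ^ n] stands for the word of [r] at length [n], so one sequence
    lists the words of all lengths. *)
Lemma Rsum_pow2_levels (s : (nat -> bool) -> nat -> R) (n : nat) :
  (forall w, s w 0%nat = 0) ->
  Rsum (fun i => s (Nat.testbit (i - 2 ^ Nat.log2 i)) (Nat.log2 i)) (2 ^ S n)
  = Rsum (fun j => level_sum s (S j)) n.
Proof.
  intros H0. induction n as [|n IH].
  (* Both indices [0] and [1] have [Nat.log2] equal to [0] and code the empty word. *)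
  - simpl. rewrite !H0. ring.
  - replace (2 ^ S (S n))%nat with (2 ^ S n + 2 ^ S n)%nat by (simpl; lia).
    rewrite Rsum_add, IH.
    change (Rsum (fun j => level_sum s (S j)) (S n)) with
      (Rsum (fun j => level_sum s (S j)) n + level_sum s (S n)).
    f_equal. apply Rsum_ext. intros r Hr.
    replace (Nat.log2 (2 ^ S n + r)) with (S n).
    + f_equal. f_equal. lia.
    + symmetry. apply Nat.log2_unique; [lia|]. rewrite (Nat.pow_succ_r' 2 (S n)). lia.
Qed.

(** * The public log-likelihood ratio *)

Section SocialLearning.

Variables (sigma : R) (Phi : R -> R).
Hypothesis sigma_pos : 0 < sigma.
Hypothesis Phi_cdf : is_std_normal_cdf Phi.

Local Notation p := (act_prob sigma Phi true).
Local Notation Dp := (D_plus sigma Phi).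
Local Notation Dm := (D_minus sigma Phi).
Local Notation ell := (pub_llr sigma Phi).
Local Notation prob := (cyl_prob sigma Phi).
Local Notation up l := (sigma * l / 2 + / sigma).
Local Notation um l := (sigma * l / 2 - / sigma).

Lemma inv_sigma_pos : 0 < / sigma.
Proof. now apply Rinv_0_lt_compat. Qed.

Lemma G_plus_opp (l : R) : G_plus sigma Phi (- l) = 1 - Phi (up l).
Proof.
  rewrite <- (Phi_opp Phi Phi_cdf). unfold G_plus, F_plus. f_equal. field. lra.
Qed.

Lemma G_minus_opp (l : R) : G_minus sigma Phi (- l) = 1 - Phi (um l).
Proof.
  rewrite <- (Phi_opp Phi Phi_cdf). unfold G_minus, F_minus. f_equal. field. lra.
Qed.

Lemma act_prob_true (l : R) : p l = Phi (up l).
Proof. simpl. rewrite G_plus_opp. ring. Qed.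

Lemma act_prob_false (l : R) : act_prob sigma Phi false l = 1 - p l.
Proof. simpl. ring. Qed.

Lemma p_bounds (l : R) : 0 < p l < 1.
Proof.
  rewrite act_prob_true. split; [now apply Phi_pos|now apply Phi_lt_1].
Qed.

Lemma act_prob_bounds (b : bool) (l : R) : 0 < act_prob sigma Phi b l < 1.
Proof.
  pose proof (p_bounds l). destruct b; [assumption|rewrite act_prob_false; lra].
Qed.

Lemma D_plus_eq (l : R) : Dp l = ln (Phi (up l)) - ln (Phi (um l)).
Proof.
  unfold D_plus. rewrite G_plus_opp, G_minus_opp.
  replace (1 - (1 - Phi (up l))) with (Phi (up l)) by ring.
  replace (1 - (1 - Phi (um l))) with (Phi (um l)) by ring.
  apply ln_div; now apply Phi_pos.
Qed.

(** Bayes' rule: [Phi (um l)] is the probability of a [+1] under [theta = -1]. *)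
Lemma likelihood_true (l : R) : p l * exp (- (l + Dp l)) = exp (- l) * Phi (um l).
Proof.
  rewrite act_prob_true, D_plus_eq.
  replace (- (l + (ln (Phi (up l)) - ln (Phi (um l)))))
    with (- l + (ln (Phi (um l)) + - ln (Phi (up l)))) by ring.
  rewrite !exp_plus, (exp_Ropp (ln _)), !exp_ln by (now apply Phi_pos).
  pose proof (Phi_pos _ Phi_cdf (up l)). field. lra.
Qed.

Lemma likelihood_false (l : R) :
  (1 - p l) * exp (- (l + Dm l)) = exp (- l) * (1 - Phi (um l)).
Proof.
  rewrite act_prob_true. unfold D_minus. rewrite G_plus_opp, G_minus_opp.
  pose proof (Phi_lt_1 _ Phi_cdf (up l)). pose proof (Phi_lt_1 _ Phi_cdf (um l)).
  rewrite ln_div by lra.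
  replace (- (l + (ln (1 - Phi (up l)) - ln (1 - Phi (um l)))))
    with (- l + (ln (1 - Phi (um l)) + - ln (1 - Phi (up l)))) by ring.
  rewrite !exp_plus, (exp_Ropp (ln _)), !exp_ln by lra. field. lra.
Qed.

Lemma exp_opp_llr_martingale (l : R) :
  p l * exp (- (l + Dp l)) + (1 - p l) * exp (- (l + Dm l)) = exp (- l).
Proof. rewrite likelihood_true, likelihood_false. ring. Qed.

(** This is [Phi_shift_le] after reflection. Combined with [likelihood_false], it says that a [-1]
    leaves the public log-likelihood ratio at most [0]. *)
Lemma overturn_tail (l : R) : 1 - Phi (up l) <= exp (- l) * (1 - Phi (um l)).
Proof.
  rewrite <- !(Phi_opp Phi Phi_cdf). pose proof inv_sigma_pos.
  replace (- (up l)) with (- (sigma * l / 2) - / sigma) by ring.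
  replace (- (um l)) with (- (sigma * l / 2) + / sigma) by ring.
  replace (- l) with (2 * - (sigma * l / 2) * / sigma) by (field; lra).
  apply Phi_shift_le; [assumption|lra].
Qed.

(* From [l], the probability of ever seeing another [-1] is at most [e^{-l}],
   because such an action pushes the martingale [e^{-l}] above [1]. *)
Lemma stay_prob_step (l : R) : 1 - exp (- l) <= p l * (1 - exp (- (l + Dp l))).
Proof.
  pose proof (overturn_tail l). pose proof (likelihood_true l).
  rewrite act_prob_true in *. lra.
Qed.

(** From [ln z <= z - 1] at [z = Phi (um l) / Phi (up l)], together with [Phi (up l) < 1]. *)
Lemma Phi_increment_le_D_plus (l : R) : Phi (up l) - Phi (um l) <= Dp l.
Proof.
  rewrite D_plus_eq. pose proof inv_sigma_pos.
  pose proof (Phi_pos _ Phi_cdf (up l)) as H1. pose proof (Phi_pos _ Phi_cdf (um l)) as H2.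
  pose proof (Phi_increasing _ Phi_cdf (um l) (up l) ltac:(lra)) as H3.
  pose proof (Phi_lt_1 _ Phi_cdf (up l)) as H4.
  assert (Hl : ln (Phi (um l) / Phi (up l)) <= Phi (um l) / Phi (up l) - 1)
    by (apply ln_le_sub_1, Rdiv_lt_0_compat; lra).
  rewrite ln_div in Hl by lra.
  cut (Phi (up l) - Phi (um l) <= 1 - Phi (um l) / Phi (up l)); [lra|].
  apply Rmult_le_reg_r with (Phi (up l)); [lra|].
  replace ((1 - Phi (um l) / Phi (up l)) * Phi (up l)) with (Phi (up l) - Phi (um l))
    by (field; lra).
  nra.
Qed.

Lemma D_plus_ge (l : R) :
  2 * / sigma * gauss_density (Rabs (sigma * l / 2) + / sigma) <= Dp l.
Proof.
  eapply Rle_trans; [|apply Phi_increment_le_D_plus].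
  apply Phi_increment_ge; [assumption|]. pose proof inv_sigma_pos. lra.
Qed.

Lemma D_plus_pos (l : R) : 0 < Dp l.
Proof.
  eapply Rlt_le_trans; [|apply D_plus_ge]. pose proof inv_sigma_pos.
  apply Rmult_lt_0_compat; [lra|apply gauss_density_pos].
Qed.

Lemma D_plus_ge_bounded (l B : R) : Rabs l <= B ->
  2 * / sigma * gauss_density (sigma * B / 2 + / sigma) <= Dp l.
Proof.
  intros H. eapply Rle_trans; [|apply D_plus_ge]. pose proof inv_sigma_pos.
  apply Rmult_le_compat_l; [lra|].
  pose proof (Rabs_pos (sigma * l / 2)).
  apply gauss_density_antitone; [lra|]. apply Rplus_le_compat_r.
  unfold Rdiv. rewrite !Rabs_mult, (Rabs_right sigma), (Rabs_right (/ 2)) by lra.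
  nra.
Qed.

(** Here [um l >= 1], so [Phi (um l) >= 1 / 2] and [- ln (Phi (um l))] is at most twice the upper
    tail beyond [um l]. *)
Lemma D_plus_le (l : R) : / sigma + 1 <= sigma * l / 2 ->
  Dp l <= 2 * exp (- (um l * um l) / 2).
Proof.
  intros Hl. rewrite D_plus_eq. pose proof (Phi_lt_1 _ Phi_cdf (up l)) as H1.
  pose proof (Phi_pos _ Phi_cdf (up l)) as H2.
  assert (Hup : ln (Phi (up l)) <= 0) by (pose proof (ln_le_sub_1 _ H2); lra).
  assert (Ht : Phi (- um l) <= exp (- (um l * um l) / 2)).
  { replace (- (um l * um l) / 2) with (- (- um l * - um l) / 2) by (unfold Rdiv; ring).
    apply Phi_le_exp; [assumption|lra]. }
  assert (Hh : 1 / 2 <= Phi (um l)).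
  { rewrite <- (Phi_0 _ Phi_cdf). apply Phi_monotone; [assumption|lra]. }
  assert (Hln : ln (/ Phi (um l)) <= / Phi (um l) - 1)
    by (apply ln_le_sub_1, Rinv_0_lt_compat; lra).
  rewrite ln_Rinv in Hln by lra.
  rewrite Phi_opp in Ht by assumption.
  cut (/ Phi (um l) - 1 <= 2 * (1 - Phi (um l))); [lra|].
  apply Rmult_le_reg_r with (Phi (um l)); [lra|].
  replace ((/ Phi (um l) - 1) * Phi (um l)) with (1 - Phi (um l)) by (field; lra).
  pose proof (Phi_lt_1 _ Phi_cdf (um l)). nra.
Qed.

(* [eta l] bounds from below the probability of playing [+1] forever from [l]. *)
Lemma stay_forever_bound (M : R) : 0 < M ->
  exists (eta : R -> R) (delta : R), 0 < delta < 1 /\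
    (forall l, - M < l -> delta <= eta l <= 1) /\
    (forall l, - M < l -> eta l <= p l * eta (l + Dp l)).
Proof.
  intros HM.
  set (p0 := p (- M)). pose proof (p_bounds (- M)) as Hp0. fold p0 in Hp0.
  assert (Hp : forall l, - M < l -> p0 <= p l).
  { intros l Hl. unfold p0. rewrite !act_prob_true. apply Phi_monotone; [assumption|]. nra. }
  set (d0 := 2 * / sigma * gauss_density (sigma * (M + 1) / 2 + / sigma)).
  assert (Hd0 : 0 < d0).
  { pose proof inv_sigma_pos. apply Rmult_lt_0_compat; [lra|apply gauss_density_pos]. }
  assert (Hd : forall l, - M < l -> l < 1 -> d0 <= Dp l).
  { intros l H1 H2. apply D_plus_ge_bounded. apply Rabs_le. lra. }
  (* Chosen so that [p0 * exp (B * d0) = 1]: below [1], the growth of [eta] over one step offsets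
     the survival probability. *)
  set (B := - ln p0 / d0).
  assert (Hlnp0 : ln p0 < 0) by (rewrite <- ln_1; apply ln_increasing; lra).
  assert (HB : 0 < B) by (apply Rdiv_lt_0_compat; lra).
  assert (HBd : B * d0 = - ln p0) by (unfold B; field; lra).
  set (e1 := 1 - exp (- (1))).
  assert (He1 : 0 < e1 < 1).
  { unfold e1. pose proof (exp_pos (- (1))).
    pose proof (exp_increasing (- (1)) 0 ltac:(lra)). rewrite exp_0 in *. lra. }
  (* From [1] on, [stay_prob_step] applies. The factor [e1 * p0] pays for the step that crosses [1],
     after which [eta] is at least [e1]. *)
  set (eta := fun l => if Rlt_dec l 1 then e1 * p0 * exp (B * (l - 1)) else 1 - exp (- l)).
  assert (Hlow : forall l, l < 1 -> eta l = e1 * p0 * exp (B * (l - 1))).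
  { intros l Hl. unfold eta. destruct (Rlt_dec l 1); [reflexivity|lra]. }
  assert (Hhigh : forall l, 1 <= l -> eta l = 1 - exp (- l)).
  { intros l Hl. unfold eta. destruct (Rlt_dec l 1); [lra|reflexivity]. }
  assert (Hhe1 : forall l, 1 <= l -> e1 <= 1 - exp (- l)).
  { intros l Hl. unfold e1. pose proof (exp_le_mono (- l) (- (1)) ltac:(lra)). lra. }
  assert (Hexp1 : forall l, l < 1 -> exp (B * (l - 1)) <= 1).
  { intros l Hl. apply Rle_trans with (exp 0); [apply exp_le_mono; nra|rewrite exp_0; lra]. }
  assert (Hep : 0 < e1 * p0 < 1) by (split; nra).
  assert (Hlep : forall l, l < 1 -> eta l <= e1 * p0).
  { intros l Hl. rewrite Hlow by exact Hl. specialize (Hexp1 l Hl). nra. }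
  exists eta, (e1 * p0 * exp (B * (- M - 1))).
  assert (Hdm : exp (B * (- M - 1)) <= 1) by (apply Hexp1; lra).
  pose proof (exp_pos (B * (- M - 1))) as Hdp.
  split; [split; nra|]. split.
  - intros l Hl. destruct (Rlt_dec l 1) as [L|L].
    + split; [|specialize (Hlep l L); lra].
      rewrite Hlow by exact L. apply Rmult_le_compat_l; [lra|]. apply exp_le_mono. nra.
    + rewrite Hhigh by lra. specialize (Hhe1 l ltac:(lra)). pose proof (exp_pos (- l)). split; nra.
  - intros l Hl. specialize (Hp l Hl). pose proof (D_plus_pos l) as HD.
    destruct (Rlt_dec l 1) as [L|L].
    + destruct (Rlt_dec (l + Dp l) 1) as [L'|L'].
      * rewrite (Hlow l L), (Hlow _ L'). specialize (Hd l Hl L).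
        apply Rle_trans with (p0 * (e1 * p0 * exp (B * (l + Dp l - 1)))).
        -- replace (B * (l + Dp l - 1)) with (B * (l - 1) + B * Dp l) by ring.
           rewrite exp_plus.
           assert (HpB : 1 <= p0 * exp (B * Dp l)).
           { apply Rle_trans with (p0 * exp (- ln p0)).
             - rewrite exp_Ropp, exp_ln by lra. right. field. lra.
             - apply Rmult_le_compat_l; [lra|]. apply exp_le_mono. rewrite <- HBd. nra. }
           pose proof (exp_pos (B * (l - 1))).
           replace (p0 * (e1 * p0 * (exp (B * (l - 1)) * exp (B * Dp l))))
             with ((e1 * p0 * exp (B * (l - 1))) * (p0 * exp (B * Dp l))) by ring.
           assert (0 < e1 * p0 * exp (B * (l - 1))) by (apply Rmult_lt_0_compat; lra).
           nra.
        -- apply Rmult_le_compat_r; [|exact Hp].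
           apply Rmult_le_pos; [lra|left; apply exp_pos].
      * specialize (Hlep l L). rewrite (Hhigh (l + Dp l)) by lra.
        specialize (Hhe1 (l + Dp l) ltac:(lra)). nra.
    + rewrite !Hhigh by lra. apply stay_prob_step.
Qed.

(** * Cylinder probabilities and covers by stopped words *)

Lemma adapted_pub_llr : adapted ell.
Proof.
  intros n w w'. induction n as [|n IH]; intros H; [reflexivity|].
  simpl. rewrite (H n) by lia. rewrite IH; [reflexivity|].
  intros k Hk. apply H. lia.
Qed.

Lemma adapted_cyl_prob : adapted prob.
Proof.
  intros n w w'. induction n as [|n IH]; intros H; [reflexivity|].
  assert (H' : in_cyl w n w') by (intros k Hk; apply H; lia).
  cbn [cyl_prob]. rewrite (H n) by lia. now rewrite IH, (adapted_pub_llr n w w').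
Qed.

Lemma pub_llr_extend (w : nat -> bool) (n : nat) (b : bool) :
  ell (extend w n b) (S n) = ell w n + (if b then Dp else Dm) (ell w n).
Proof.
  cbn [pub_llr]. rewrite extend_at, (adapted_pub_llr n w) by apply extend_cyl.
  now destruct b.
Qed.

Lemma cyl_prob_extend (w : nat -> bool) (n : nat) (b : bool) :
  prob (extend w n b) (S n) = prob w n * act_prob sigma Phi b (ell w n).
Proof.
  cbn [cyl_prob]. rewrite extend_at, (adapted_pub_llr n w), (adapted_cyl_prob n w)
    by apply extend_cyl. reflexivity.
Qed.

Lemma cyl_prob_pos (w : nat -> bool) (n : nat) : 0 < prob w n.
Proof.
  induction n as [|n IH]; cbn [cyl_prob]; [lra|].
  apply Rmult_lt_0_compat; [exact IH|apply act_prob_bounds].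
Qed.

(** Always follow an action of conditional probability at most [1 / 2]. *)
Lemma exists_small_cylinder (n : nat) : exists w, prob w n <= (1 / 2) ^ n.
Proof.
  induction n as [|n [w Hw]].
  - exists (fun _ => true). simpl. lra.
  - pose proof (cyl_prob_pos w n) as Hpos. pose proof (p_bounds (ell w n)) as Hp.
    destruct (Rle_dec (p (ell w n)) (1 / 2)) as [L|L].
    + exists (extend w n true). rewrite cyl_prob_extend. simpl pow. nra.
    + exists (extend w n false). rewrite cyl_prob_extend, act_prob_false.
      simpl pow. nra.
Qed.

(** A cover must assign a cylinder to every index; indices whose word is not a stopped one receive
    these, of total mass at most [eps]. *)
Lemma exists_padding (eps : R) : 0 < eps ->
  exists (w : nat -> nat -> bool) (len : nat -> nat),
    forall i, prob (w i) (len i) <= eps * (1 / 2) ^ S i.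
Proof.
  intros Heps.
  assert (HN : exists N, (1 / 2) ^ N <= eps).
  { destruct (pow_lt_1_zero (1 / 2) ltac:(rewrite Rabs_right; lra) eps Heps) as [N HN].
    exists N. specialize (HN N (le_n N)). rewrite Rabs_right in HN; [lra|].
    apply Rle_ge, pow_le. lra. }
  destruct HN as [N HN].
  exists (fun i => proj1_sig (constructive_indefinite_description _
                     (exists_small_cylinder (N + S i)))), (fun i => N + S i)%nat.
  intros i. destruct (constructive_indefinite_description _ _) as [w Hw]. cbn [proj1_sig].
  rewrite pow_add in Hw. eapply Rle_trans; [exact Hw|].
  apply Rmult_le_compat_r; [apply pow_le; lra|exact HN].
Qed.

(* [first a n] says that [a] is stopped exactly after [n] actions; the supermartingale
   [U] dominates the mass still to be stopped. *)
Lemma null_set_of_stopping (N : (nat -> bool) -> Prop) :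
  (forall eps, 0 < eps ->
    exists (first : (nat -> bool) -> nat -> bool) (U : (nat -> bool) -> nat -> R),
      let s := fun w n => if first w n then prob w n else 0 in
      adapted first /\ adapted U /\
      (forall w n, 0 <= U w n) /\
      (forall w, U w 0%nat <= eps) /\
      (forall w, first w 0%nat = false) /\
      (forall w n, s (extend w n false) (S n) + U (extend w n false) (S n)
                 + (s (extend w n true) (S n) + U (extend w n true) (S n)) <= U w n) /\
      (forall a, N a -> exists n, first a n = true)) ->
  null_set sigma Phi N.
Proof.
  intros HN eps Heps.
  destruct (HN (eps / 2) ltac:(lra)) as [first [U [Hfirst [HU [HU0 [HUe [Hf0 [Hsup Hcov]]]]]]]].
  set (s := fun w n => if first w n then prob w n else 0) in *.
  destruct (exists_padding (eps / 2) ltac:(lra)) as [pw [pl Hpad]].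
  set (word := fun i => Nat.testbit (i - 2 ^ Nat.log2 i)).
  exists (fun i => if first (word i) (Nat.log2 i) then word i else pw i),
         (fun i => if first (word i) (Nat.log2 i) then Nat.log2 i else pl i).
  split.
  - intros a Ha. destruct (Hcov a Ha) as [n Hn].
    destruct (testbit_prefix a n) as [r [Hr Hc]].
    exists (2 ^ n + r)%nat. unfold word.
    rewrite (Nat.log2_unique (2 ^ n + r) n) by (rewrite ?Nat.pow_succ_r'; lia).
    replace (2 ^ n + r - 2 ^ n)%nat with r by lia.
    rewrite <- (Hfirst n _ _ Hc), Hn. exact Hc.
  - intros m. rewrite sum_f_R0_Rsum.
    assert (Hs0 : forall w n, 0 <= s w n).
    { intros w n. unfold s. destruct (first w n); [left; apply cyl_prob_pos|lra]. }
    assert (Hsa : adapted s).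
    { intros n w w' H. unfold s. rewrite (Hfirst n w w' H).
      now rewrite (adapted_cyl_prob n w w' H). }
    apply Rle_trans with (Rsum (fun i => s (word i) (Nat.log2 i) + eps / 2 * (1 / 2) ^ S i) (S m)).
    + apply Rsum_le. intros i _. unfold s.
      assert (0 <= eps / 2 * (1 / 2) ^ S i) by (apply Rmult_le_pos; [lra|apply pow_le; lra]).
      destruct (first (word i) (Nat.log2 i)); [lra|]. rewrite Rplus_0_l. apply Hpad.
    + rewrite Rsum_plus. apply Rle_trans with (eps / 2 + eps / 2); [|lra].
      apply Rplus_le_compat.
      (* Enlarge the partial sum to complete levels, where the telescoped bound applies. *)
      * apply Rle_trans with (Rsum (fun i => s (word i) (Nat.log2 i)) (2 ^ S (S m))).
        { apply Rsum_monotone; [intros; apply Hs0|].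
          pose proof (Nat.pow_gt_lin_r 2 (S (S m)) ltac:(lia)). lia. }
        unfold word. rewrite Rsum_pow2_levels by (intros w; unfold s; now rewrite Hf0).
        pose proof (level_sum_stopped s U (S m) Hsa HU Hsup).
        assert (0 <= level_sum U (S m)).
        { unfold level_sum. generalize (2 ^ S m)%nat. intros k.
          induction k; simpl Rsum; [lra|]. pose proof (HU0 (Nat.testbit k) (S m)). lra. }
        pose proof (HUe (Nat.testbit 0)). lra.
      * pose proof (Rsum_half_pow (S m)) as Hh.
        replace (Rsum (fun i => eps / 2 * (1 / 2) ^ S i) (S m))
          with (eps / 2 * Rsum (fun i => (1 / 2) ^ S i) (S m)); [nra|].
        generalize (S m). clear. induction n as [|n IH]; simpl in *; [ring|].
        rewrite <- IH. ring.
Qed.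

(** * Stopping at a low public belief or at the [K]-th action [-1] *)

Fixpoint falses (w : nat -> bool) (n : nat) : nat :=
  match n with
  | O => O
  | S m => if w m then falses w m else S (falses w m)
  end.

Lemma adapted_falses : adapted falses.
Proof.
  intros n w w'. induction n as [|n IH]; intros H; [reflexivity|].
  simpl. rewrite (H n) by lia. rewrite IH; [reflexivity|].
  intros k Hk. apply H. lia.
Qed.

Lemma falses_extend (w : nat -> bool) (n : nat) (b : bool) :
  falses (extend w n b) (S n) = if b then falses w n else S (falses w n).
Proof.
  simpl. rewrite extend_at, (adapted_falses n w) by apply extend_cyl. reflexivity.
Qed.

Lemma falses_monotone (w : nat -> bool) (n m : nat) :
  (n <= m)%nat -> (falses w n <= falses w m)%nat.
Proof. induction 1; simpl; [lia|]. destruct (w m); lia. Qed.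

Lemma falses_unbounded (w : nat -> bool) :
  (forall n, exists m, (n <= m)%nat /\ w m = false) ->
  forall K, exists n, (K <= falses w n)%nat.
Proof.
  intros H K. induction K as [|K [n Hn]]; [exists 0%nat; lia|].
  destruct (H n) as [m [Hm E]]. exists (S m). simpl. rewrite E.
  pose proof (falses_monotone w n m Hm). lia.
Qed.

Definition stopped (M : R) (K : nat) (w : nat -> bool) (n : nat) : bool :=
  if Rle_dec (ell w n) (- M) then true else Nat.leb K (falses w n).

Fixpoint alive (M : R) (K : nat) (w : nat -> bool) (n : nat) : bool :=
  match n with
  | O => true
  | S m => (alive M K w m && negb (stopped M K w n))%bool
  end.

Definition first_stop (M : R) (K : nat) (w : nat -> bool) (n : nat) : bool :=
  match n with
  | O => false
  | S m => (alive M K w m && stopped M K w n)%bool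
  end.

Lemma adapted_stopped (M : R) (K : nat) : adapted (stopped M K).
Proof.
  intros n w w' H. unfold stopped.
  now rewrite (adapted_pub_llr n w w' H), (adapted_falses n w w' H).
Qed.

Lemma adapted_alive (M : R) (K : nat) : adapted (alive M K).
Proof.
  intros n w w'. induction n as [|n IH]; intros H; [reflexivity|].
  cbn [alive]. rewrite (adapted_stopped M K (S n) w w' H), IH; [reflexivity|].
  intros k Hk. apply H. lia.
Qed.

Lemma adapted_first_stop (M : R) (K : nat) : adapted (first_stop M K).
Proof.
  intros [|n] w w' H; [reflexivity|]. unfold first_stop.
  rewrite (adapted_stopped M K (S n) w w' H), (adapted_alive M K n w w'); [reflexivity|].
  intros k Hk. apply H. lia.
Qed.

Lemma exists_first_stop (M : R) (K : nat) (w : nat -> bool) (n : nat) :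
  alive M K w n = false -> exists m, first_stop M K w m = true.
Proof.
  induction n as [|n IH]; simpl; [discriminate|].
  destruct (alive M K w n) eqn:E; [|auto].
  intros H. exists (S n). simpl. rewrite E. simpl in *.
  now destruct (stopped M K w (S n)).
Qed.

Lemma alive_bounds (M : R) (K : nat) (w : nat -> bool) (n : nat) :
  0 < M -> (0 < K)%nat -> alive M K w n = true ->
  - M < ell w n /\ (falses w n < K)%nat.
Proof.
  intros HM HK. destruct n as [|n].
  - intros _. simpl. split; [lra|exact HK].
  - cbn [alive]. intros H. apply andb_prop in H. destruct H as [_ H].
    unfold stopped in H. destruct (Rle_dec (ell w (S n)) (- M)); [discriminate|].
    split; [lra|]. destruct (Nat.leb_spec K (falses w (S n))); [discriminate|assumption].
Qed.

(** The first term bounds the chance of ever falling to [- M]. The second bounds the chance of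
    reaching [K] actions [-1] after [k] of them: [1 - eta l] for the next, [rho] for each later one.
    Inverse powers avoid truncated subtraction. *)
Definition potential (M : R) (K : nat) (rho : R) (eta : R -> R) (l : R) (k : nat) : R :=
  exp (- M) * exp (- l) + rho ^ K * (/ rho) ^ S k * (1 - eta l).

(* Up to probability [e^{-M}] the path stays above [-M]; there each [-1] is followed by another one
   with probability at most [rho < 1]. *)
Lemma infinitely_many_false_null :
  null_set sigma Phi (fun a => forall n, exists m, (n <= m)%nat /\ a m = false).
Proof.
  apply null_set_of_stopping. intros eps Heps.
  assert (HM : exists M, 0 < M /\ exp (- M) <= eps / 2).
  { exists (Rmax 1 (- ln (eps / 2))). pose proof (Rmax_l 1 (- ln (eps / 2))).
    pose proof (Rmax_r 1 (- ln (eps / 2))). split; [lra|].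
    rewrite <- (exp_ln (eps / 2)) at 2 by lra. apply exp_le_mono. lra. }
  destruct HM as [M [HM HMe]].
  destruct (stay_forever_bound M HM) as [eta [delta [Hdelta [Heta Hstep]]]].
  set (rho := 1 - delta). assert (Hrho : 0 < rho < 1) by (unfold rho; lra).
  assert (HK : exists K, (0 < K)%nat /\ rho ^ K <= eps / 2).
  { destruct (pow_lt_1_zero rho ltac:(rewrite Rabs_right; lra) (eps / 2) ltac:(lra)) as [K HK].
    exists (S K). split; [lia|]. specialize (HK (S K) ltac:(lia)).
    rewrite Rabs_right in HK; [lra|]. apply Rle_ge, pow_le. lra. }
  destruct HK as [K [HK HKe]].
  set (v := potential M K rho eta).
  assert (HA : forall k, 0 < rho ^ K * (/ rho) ^ S k).
  { intros k. apply Rmult_lt_0_compat; apply pow_lt; [lra|]. apply Rinv_0_lt_compat. lra. }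
  assert (Hv : forall l k, - M < l -> 0 <= v l k).
  { intros l k Hl. unfold v, potential. specialize (HA k). specialize (Heta l Hl).
    pose proof (Rmult_lt_0_compat _ _ (exp_pos (- M)) (exp_pos (- l))). nra. }
  exists (first_stop M K),
    (fun w n => if alive M K w n then prob w n * v (ell w n) (falses w n) else 0).
  cbv zeta. split; [apply adapted_first_stop|]. split; [|split; [|split; [|split; [|split]]]].
  - intros n w w' H. now rewrite (adapted_alive M K n w w' H), (adapted_cyl_prob n w w' H),
      (adapted_pub_llr n w w' H), (adapted_falses n w w' H).
  - intros w n. destruct (alive M K w n) eqn:E; [|lra].
    apply alive_bounds in E; [|assumption..].
    apply Rmult_le_pos; [left; apply cyl_prob_pos|now apply Hv].
  - intros w. simpl. unfold v, potential. rewrite Ropp_0, exp_0.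
    specialize (Heta 0 ltac:(lra)).
    assert (Hr : / rho * (1 - eta 0) <= 1).
    { apply Rmult_le_reg_l with rho; [lra|]. rewrite <- Rmult_assoc, Rinv_r by lra.
      unfold rho. lra. }
    assert (0 <= rho ^ K) by (apply pow_le; lra).
    simpl. nra.
  - reflexivity.
  - intros w n. cbn [first_stop alive]. rewrite (adapted_alive M K n w _ (extend_cyl w n true)),
      (adapted_alive M K n w _ (extend_cyl w n false)).
    destruct (alive M K w n) eqn:E; [|simpl; lra].
    apply alive_bounds in E; [|assumption..]. destruct E as [El Ek].
    set (l := ell w n) in *. set (k := falses w n) in *.
    assert (Ht : stopped M K (extend w n true) (S n) = false).
    { unfold stopped. rewrite pub_llr_extend, falses_extend. fold l k.
      pose proof (D_plus_pos l). destruct (Rle_dec (l + Dp l) (- M)); [lra|].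
      now apply Nat.leb_gt. }
    rewrite Ht, !cyl_prob_extend, !pub_llr_extend, !falses_extend. fold l k.
    cbn [andb negb]. rewrite act_prob_false.
    (* After a [-1], a fall to [- M] is paid by the first term, which is then at least [1]; the
       [K]-th [-1] by [rho ^ K * (/ rho) ^ K = 1]; otherwise [1 - eta <= rho] absorbs the extra
       factor [/ rho]. *)
    assert (Hf : (if stopped M K (extend w n false) (S n) then prob w n * (1 - p l) else 0)
       + (if negb (stopped M K (extend w n false) (S n))
          then prob w n * (1 - p l) * v (l + Dm l) (S k) else 0)
       <= prob w n * (1 - p l) * (exp (- M) * exp (- (l + Dm l)) + rho ^ K * (/ rho) ^ S k)).
    { pose proof (p_bounds l). pose proof (cyl_prob_pos w n).
      assert (0 <= prob w n * (1 - p l)) by nra.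
      pose proof (exp_pos (- M)). pose proof (exp_pos (- (l + Dm l))).
      specialize (HA k).
      unfold stopped. rewrite pub_llr_extend, falses_extend. fold l k.
      destruct (Rle_dec (l + Dm l) (- M)) as [L|L].
      - cbn [negb].
        assert (1 <= exp (- M) * exp (- (l + Dm l))).
        { rewrite <- exp_plus, <- exp_0. apply exp_le_mono. lra. }
        nra.
      - destruct (Nat.leb_spec K (S k)) as [LK|LK]; cbn [negb].
        + assert (EK : S k = K) by lia. rewrite EK.
          rewrite <- Rpow_mult_distr, Rinv_r, pow1 by lra.
          assert (0 < exp (- M) * exp (- (l + Dm l))) by (apply Rmult_lt_0_compat; lra).
          nra.
        + rewrite Rplus_0_l. apply Rmult_le_compat_l; [assumption|].
          unfold v, potential. apply Rplus_le_compat_l.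
          specialize (Heta (l + Dm l) ltac:(lra)).
          change ((/ rho) ^ S (S k)) with (/ rho * (/ rho) ^ S k).
          apply Rle_trans with (rho ^ K * (/ rho) ^ S k * (/ rho * (1 - eta (l + Dm l))));
            [right; ring|].
          rewrite <- (Rmult_1_r (rho ^ K * (/ rho) ^ S k)) at 2.
          apply Rmult_le_compat_l; [lra|].
          apply Rmult_le_reg_l with rho; [lra|]. rewrite <- Rmult_assoc, Rinv_r by lra.
          unfold rho. lra. }
    eapply Rle_trans; [apply Rplus_le_compat_r, Hf|].
    rewrite Rplus_0_l.
    pose proof (exp_opp_llr_martingale l) as Hmart.
    unfold v, potential. pose proof (cyl_prob_pos w n).
    specialize (Hstep l El). specialize (HA k). rewrite <- Hmart.
    set (A := rho ^ K * (/ rho) ^ S k) in *.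
    (* The martingale terms balance exactly; what remains is [eta l <= p l * eta (l + Dp l)]. *)
    cut (A * ((1 - p l) + p l * (1 - eta (l + Dp l))) <= A * (1 - eta l)).
    { intros HAA. apply Rmult_le_compat_l with (r := prob w n) in HAA; lra. }
    apply Rmult_le_compat_l; lra.
  - intros a Ha. destruct (falses_unbounded a Ha K) as [n Hn].
    apply (exists_first_stop M K a n).
    destruct (alive M K a n) eqn:E; [|reflexivity].
    apply alive_bounds in E; [|assumption..]. lia.
Qed.

(** * From herds to the almost sure limit *)

Lemma pub_llr_cv_of_herd (a : nat -> bool) (N : nat) :
  (forall n, (N <= n)%nat -> a n = true) ->
  Un_cv (fun n => ell a n / ((2 * sqrt 2 / sigma) * sqrt (ln (INR (S n))))) 1.
Proof.
  intros Ha. pose proof inv_sigma_pos as Hc.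
  assert (Hstep : forall n, (N <= n)%nat ->
    sigma * ell a (S n) / 2 - sigma * ell a n / 2 = sigma / 2 * Dp (ell a n)).
  { intros n Hn. cbn [pub_llr]. rewrite Ha by exact Hn. field. }
  assert (Hcv : Un_cv (fun n => sigma * ell a n / 2 / (sqrt 2 * sqrt (ln (INR (S n))))) 1).
  { apply (herd_asymptotics (/ sigma) sigma (fun n => sigma * ell a n / 2) N);
      [assumption..| |]; intros n Hn.
    - rewrite Hstep by exact Hn.
      apply Rle_trans with (sigma / 2 * (2 * / sigma *
          gauss_density (Rabs (sigma * ell a n / 2) + / sigma))); [right; field; lra|].
      apply Rmult_le_compat_l; [lra|apply D_plus_ge].
    - intros Hu. rewrite Hstep by exact Hn. pose proof (D_plus_le (ell a n) Hu). nra. }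
  (* The successor excludes [n = 0], where the logarithm vanishes and the rescaling would divide by
     [0]. *)
  intros eps Heps. destruct (Hcv eps Heps) as [n0 Hn0]. exists (S n0). intros n Hn.
  specialize (Hn0 n ltac:(lia)).
  replace (ell a n / (2 * sqrt 2 / sigma * sqrt (ln (INR (S n)))))
    with (sigma * ell a n / 2 / (sqrt 2 * sqrt (ln (INR (S n))))); [exact Hn0|].
  assert (0 < sqrt 2) by (apply sqrt_lt_R0; lra).
  assert (0 < sqrt (ln (INR (S n)))).
  { apply sqrt_lt_R0. rewrite <- ln_1. apply ln_increasing; [lra|].
    change 1 with (INR 1). apply lt_INR. lia. }
  field. lra.
Qed.

End SocialLearning.

Theorem theorem4 (sigma : R) (Phi : R -> R) :
  0 < sigma ->
  is_std_normal_cdf Phi ->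
  almost_surely sigma Phi (fun a =>
    Un_cv (fun n => pub_llr sigma Phi a n /
                    ((2 * sqrt 2 / sigma) * sqrt (ln (INR (S n))))) 1).
Proof.
  intros Hsigma HPhi eps Heps.
  destruct (infinitely_many_false_null sigma Phi Hsigma HPhi eps Heps) as [w [len [Hcov Hsum]]].
  exists w, len. split; [|exact Hsum].
  (* A path without the limit must contain infinitely many [-1], so the same cover serves. *)
  intros a Ha. apply Hcov. intros n. apply NNPP. intros Hn. apply Ha.
  apply (pub_llr_cv_of_herd sigma Phi Hsigma HPhi a n). intros m Hm.
  destruct (a m) eqn:E; [reflexivity|]. exfalso. apply Hn. now exists m.
Qed.
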